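(* Let $(\mathbb{K},[\cdot,\cdot])$ be a Krein space with fundamental symmetry $J$, and let $\{(W_i,v_i):i\in I\}$ be a $J$-fusion frame for $\mathbb{K}$. Then $\{(J(W_i),v_i):i\in I\}$ is also a $J$-fusion frame for $\mathbb{K}$.
   Context: $\langle f,g\rangle_J=[Jf,g]$ is the Hilbert space inner product of $\mathbb{K}$ and $\|\cdot\|_J$ its norm. For a closed subspace $W$, $\pi_W$ is the orthogonal projection onto $W$ with respect to $\langle\cdot,\cdot\rangle_J$. A subspace $W$ is $J$-non-negative if $[f,f]\ge 0$ for all $f\in W$; $J$-negative if $[f,f]<0$ for all nonzero $f\in W$; uniformly $J$-positive (resp. uniformly $J$-negative) if there is $\alpha>0$ with $[f,f]\ge\alpha\|f\|_J^2$ (resp. $-[f,f]\ge\alpha\|f\|_J^2$) for all $f\in W$. Maximality is with respect to inclusion. Families $\{(W_i,v_i):i\in I\}$ consist of closed subspaces $W_i$ of $\mathbb{K}$ with weights $v_i>0$, where each $W_i$ is either $J$-non-negative or $J$-negative. $I_+$ is the set of $i$ with $W_i$ $J$-non-negative, and $I_-$ the set of $i$ with $W_i\neq\{0\}$ and $W_i$ $J$-negative. The family is Bessel if $\sum_{i}v_i^2\|\pi_{W_i}f\|_J^2\le B\|f\|_J^2$ for some $B<\infty$ and all $f\in\mathbb{K}$. Let $(\sum_{i\in I}\oplus W_i)_{\ell_2}$ be the Hilbert space of families $\{f_i\}$, $f_i\in W_i$, with $\sum\|f_i\|_J^2<\infty$. The synthesis operator is $T_{W,v}\{f_i\}=\sum_{i\in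 I}v_if_i$. Let $P_\pm$ be the orthogonal projection of this space onto $(\sum_{i\in I_\pm}\oplus W_i)_{\ell_2}$, and ${T_{W,v}}_\pm=T_{W,v}P_\pm$. The Bessel family is a $J$-fusion frame for $\mathbb{K}$ if the range $R({T_{W,v}}_+)$ is a maximal uniformly $J$-positive subspace and $R({T_{W,v}}_-)$ is a maximal uniformly $J$-negative subspace of $\mathbb{K}$. *)

(* Defs.v *)
From HB Require Import structures.
From mathcomp Require Import all_boot all_order all_algebra.
From mathcomp Require Import finmap complex.
From mathcomp Require Import all_classical all_reals all_analysis.
From mathcomp Require showcase.summability.

Set Implicit Arguments.
Unset Strict Implicit.
Unset Printing Implicit Defensive.

Import Order.TTheory GRing.Theory Num.Theory.
Import numFieldNormedType.Exports.

Local Open Scope classical_set_scope.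
Local Open Scope ring_scope.
Local Open Scope complex_scope.

Section subspaces.
Variables (R : realType) (V : lmodType R[i]).

Definition subspace (W : set V) := submod_closed (mem W).

(* The point g of W with f - g orthogonal to W. It is unique when ip is an
   inner product; if there is none (W is not a closed subspace of a Hilbert
   space) the value is 0. *)
Definition orth_proj (ip : V -> V -> R[i]) (W : set V) (f : V) : V :=
  xget 0 [set g | W g /\ forall w, W w -> ip (f - g) w = 0].

Definition maximal (P : set V -> Prop) (M : set V) :=
  P M /\ forall N, P N -> M `<=` N -> N = M.

End subspaces.

(* Unconditional sum: the limit of the finite partial sums along the finite
   subsets of I ordered by inclusion (0 if there is no limit). *)
Definition usum (R : realType) (V : normedModType R[i]) (I : choiceType)
    (x : I -> V) : V :=
  xget 0 [set s | summability.partial_sum x @ summability.totally --> s].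

Section krein.
Variables (R : realType) (K : completeNormedModType R[i]).
Variables (form : {hermitian_sym K for Num.conj}) (J : K -> K).

Local Notation "[[ f , g ]]" := (form f g).

Definition J_inner (f g : K) : R[i] := [[J f, g]].

Definition J_norm (f : K) : R := Num.sqrt (complex.Re (J_inner f f)).

(* J is f+ + f- |-> f+ - f- for a decomposition K = Kp + Km. As [ , ] and
   - [ , ] induce the J-norm on Kp and Km, their being Hilbert spaces for these
   forms means that they are closed in K. *)
Definition fundamental_symmetry :=
  exists Kp Km : set K,
    [/\ (subspace Kp /\ closed Kp) /\ (subspace Km /\ closed Km),
        forall f, exists2 p, Kp p & exists2 m, Km m & f = p + m,
        forall p m, Kp p -> Km m -> [[p, m]] = 0,
        (forall p, Kp p -> p != 0 -> 0 < [[p, p]]) /\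
        (forall m, Km m -> m != 0 -> [[m, m]] < 0) &
        forall p m, Kp p -> Km m -> J (p + m) = p - m].

(* (K, [ , ]) is a Krein space with fundamental symmetry J, K being normed by
   the J-norm; the completeness is part of the type of K. *)
Definition krein_space :=
  fundamental_symmetry /\ forall f : K, `|f| = (J_norm f)%:C.

Definition J_nonneg (W : set K) := subspace W /\ forall f, W f -> 0 <= [[f, f]].

Definition J_negative (W : set K) :=
  subspace W /\ forall f, W f -> f != 0 -> [[f, f]] < 0.

Definition unif_J_positive (W : set K) :=
  subspace W /\ exists2 alpha : R, 0 < alpha &
    forall f, W f -> (alpha * J_norm f ^+ 2)%:C <= [[f, f]].

Definition unif_J_negative (W : set K) :=
  subspace W /\ exists2 alpha : R, 0 < alpha &
    forall f, W f -> (alpha * J_norm f ^+ 2)%:C <= - [[f, f]].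

Variables (I : choiceType) (W : I -> set K) (v : I -> R).

Definition J_family := forall i,
  [/\ subspace (W i), closed (W i), 0 < v i & J_nonneg (W i) \/ J_negative (W i)].

Definition I_plus : set I := [set i | J_nonneg (W i)].

Definition I_minus : set I := [set i | W i <> [set 0] /\ J_negative (W i)].

Definition J_bessel := exists B : R, forall f : K,
  (\esum_(i in [set: I]) (v i ^+ 2 * J_norm (orth_proj J_inner (W i) f) ^+ 2)%:E
    <= (B * J_norm f ^+ 2)%:E)%E.

Definition l2_sum : set (I -> K) :=
  [set x | (forall i, W i (x i)) /\
    (\esum_(i in [set: I]) (J_norm (x i) ^+ 2)%:E < +oo)%E].

Definition l2_inner (x y : I -> K) : R[i] :=
  usum (fun i => J_inner (x i) (y i) : R[i]^o).

(* The l2-sum of the W i over i in A, as a subspace of the whole l2-sum. *)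
Definition l2_sum_on (A : set I) : set (I -> K) :=
  [set x | l2_sum x /\ forall i, ~ A i -> x i = 0].

Definition synthesis (x : I -> K) : K := usum (fun i => (v i)%:C *: x i).

Definition synthesis_on (A : set I) (x : I -> K) : K :=
  synthesis (orth_proj l2_inner (l2_sum_on A) x).

Definition J_fusion_frame :=
  [/\ J_family,
      J_bessel,
      maximal unif_J_positive (synthesis_on I_plus @` l2_sum) &
      maximal unif_J_negative (synthesis_on I_minus @` l2_sum)].

End krein.

(* Main.v *)
(** J is a linear involution which preserves both the indefinite form and the
    Hilbert space structure, so it carries every ingredient of the definition
    of a J-fusion frame for the W_i to the one for the J(W_i). In particular the
    synthesis ranges are mapped by J, and J permutes the uniformly J-positive
    (J-negative) subspaces, hence preserves the maximal ones. The only analytic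
    points are that orthogonal projections and unconditional sums, being defined
    by choice, are unique when they exist. *)
Require Import Defs.
From mathcomp Require Import all_boot all_order all_algebra complex.
From mathcomp Require Import all_classical all_reals all_analysis.
From mathcomp Require Import finmap.
Import Order.TTheory GRing.Theory Num.Theory.
Import numFieldNormedType.Exports.
Local Open Scope classical_set_scope.
Local Open Scope ring_scope.

Set Implicit Arguments.
Unset Strict Implicit.
Unset Printing Implicit Defensive.

(** * Involutions and values defined by choice *)

Lemma image_involutive (T : Type) (s : T -> T) (A : set T) :
  involutive s -> s @` A = s @^-1` A.
Proof.
move=> sK; apply/seteqP; split=> [_ [x Ax <-]|x Ax]; first by rewrite /= sK.
by exists (s x) => //; rewrite sK.
Qed.

Lemma involutive_comp (I T : Type) (s : T -> T) :
  involutive s -> involutive (fun x : I -> T => s \o x).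
Proof. by move=> sK x; apply/funext => i /=; rewrite sK. Qed.

(** If [A] has a point, uniqueness forces both choices. If [A] is empty, so is its preimage, and
    both sides are the default [x0], which [s] fixes. *)
Lemma xget_involutive (T : choiceType) (s : T -> T) (x0 : T) (A B : set T) :
  involutive s -> s x0 = x0 -> is_subset1 A -> B = s @^-1` A ->
  xget x0 B = s (xget x0 A).
Proof.
move=> sK s0 A1 ->; have [[a Aa]|A0] := pselect (exists a, A a).
  rewrite (xget_subset1 x0 Aa A1); apply: xget_subset1; first by rewrite /= sK.
  by move=> x y /= Ax Ay; apply: (can_inj sK); apply: A1.
rewrite (@xgetPN _ _ A) ?s0; last by move=> x Ax; apply: A0; exists x.
by rewrite xgetPN// => x Ax; apply: A0; exists (s x).
Qed.

(** * Orthogonal projections under an isometric involution *)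

Section orth_proj.
Variables (R : realType) (V : lmodType R[i]) (ip : V -> V -> R[i]) (s : V -> V).
Hypothesis sK : involutive s.
Hypothesis sB : {morph s : x y / x - y}.
Hypothesis sip : forall x y, ip (s x) (s y) = ip x y.

(** Uniqueness is a hypothesis here, rather than definiteness of [ip], so that the lemma also covers
    [l2_inner], which need not be an inner product on all of [I -> K]. *)
Lemma orth_proj_involutive (W : set V) (f : V) :
  is_subset1 [set g | W g /\ forall w, W w -> ip (f - g) w = 0] ->
  orth_proj ip (s @` W) (s f) = s (orth_proj ip W f).
Proof.
move=> uniq_f; apply: xget_involutive => //.
  by rewrite -[in LHS](subrr 0) sB subrr.
rewrite image_involutive//; apply/seteqP; split=> g /= [Wg fg]; split=> // w Ww.
  by rewrite -sip sB sK; apply: fg; rewrite sK.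
by rewrite -sip sB sK; apply: fg.
Qed.

End orth_proj.

(** * Unconditional sums *)

Section usum.
Variables (R : realType) (V : normedModType R[i]) (I : choiceType).

#[local] Existing Instance summability.totally_filter.

Lemma usum_set_subset1 (x : I -> V) :
  is_subset1 [set s : V | summability.partial_sum x @ summability.totally --> s].
Proof. exact: norm_cvg_unique. Qed.

(** Continuity and additivity carry limits of partial sums to limits. Applying this to [s \o x] as
    well shows that divergence is also preserved, and then both sides are 0. *)
Lemma usum_involutive (s : V -> V) (x : I -> V) :
  involutive s -> {morph s : u v / u + v} -> s 0 = 0 -> continuous s ->
  usum (s \o x) = s (usum x).
Proof.
move=> sK sD s0 sC; apply: xget_involutive => //; first exact: usum_set_subset1.
have cvgs (y : I -> V) t :
    summability.partial_sum y @ summability.totally --> t ->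
    summability.partial_sum (s \o y) @ summability.totally --> s t.
  move=> yt; have -> : summability.partial_sum (s \o y)
      = s \o summability.partial_sum y.
    apply/funext => A; rewrite /summability.partial_sum /=.
    by rewrite (big_morph s sD s0).
  by apply: cvg_comp yt _; apply: sC.
apply/seteqP; split=> t /= /cvgs //; last by rewrite sK.
by rewrite (_ : s \o (s \o x) = x)//; apply/funext => i /=; rewrite sK.
Qed.

(** The partial sums are constant once the finite set contains [i]. *)
Lemma usum_single (x : I -> V) (i : I) :
  (forall j, j != i -> x j = 0) -> usum x = x i.
Proof.
move=> x0; apply: xget_subset1; last exact: usum_set_subset1.
apply: cvg_near_cst.
exists [fset i]%fset => // A /= /fsubsetP iA.
have {}iA : i \in A by apply: iA; rewrite inE.
rewrite /summability.partial_sum (bigD1 [` iA]%fset)//= big1 ?addr0// => j ji.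
by apply: x0; apply: contra ji => /eqP ji; apply/eqP/val_inj.
Qed.

End usum.

(* The unqualified name [subspace] now denotes the subspace topology. *)
Lemma subspaceP (R : realType) (V : lmodType R[i]) (W : set V) :
  Defs.subspace W <-> W 0 /\ forall a x y, W x -> W y -> W (a *: x + y).
Proof.
split=> -[W0 WD]; split.
- exact: set_mem W0.
- move=> a x y /mem_set Wx /mem_set Wy.
  exact: set_mem (WD a x y Wx Wy).
- exact: (mem_set W0).
- by move=> a x y /set_mem Wx /set_mem Wy; apply/mem_set/WD.
Qed.

(** * The fundamental symmetry as a linear isometric involution *)

Section krein.
Variables (R : realType) (K : completeNormedModType R[i]).
Variables (form : {hermitian_sym K for Num.conj}) (J : K -> K).
Hypothesis krK : krein_space form J.

Lemma J_linear (a : R[i]) (f g : K) : J (a *: f + g) = a *: J f + J g.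
Proof.
have [[Kp [Km [[[sp _] [sm _]] dec _ _ JE]]] _] := krK.
have lin (S : set K) b x y : Defs.subspace S -> S x -> S y -> S (b *: x + y).
  by move=> /subspaceP[_]; apply.
have [p Kpp [m Kmm ->]] := dec f; have [q Kpq [n Kmn ->]] := dec g.
rewrite scalerDr addrACA !JE//; try exact: lin.
by rewrite scalerBr opprD addrACA.
Qed.

Lemma J_add : {morph J : f g / f + g}.
Proof. by move=> f g; rewrite -[f in LHS]scale1r J_linear scale1r. Qed.

Lemma J_zero : J 0 = 0.
Proof. by apply: (addrI (J 0)); rewrite -J_add !addr0. Qed.

Lemma J_scale (a : R[i]) : {morph J : f / a *: f}.
Proof. by move=> f; rewrite -[a *: f]addr0 J_linear J_zero addr0. Qed.

Lemma J_sub : {morph J : f g / f - g}.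
Proof. by move=> f g; rewrite J_add -scaleN1r J_scale scaleN1r. Qed.

Lemma J_involutive : involutive J.
Proof.
have [[Kp [Km [[_ [/subspaceP[Km0 sm] _]] dec _ _ JE]]] _] := krK.
move=> f; have [p Kpp [m Kmm ->]] := dec f.
by rewrite JE// JE ?opprK// -scaleN1r -[_ *: _]addr0; apply: sm.
Qed.

(** Cross terms vanish by orthogonality, and the two signs cancel in the [Km] term. *)
Lemma form_J (f g : K) : form (J f) (J g) = form f g.
Proof.
have [[Kp [Km [_ dec orth _ JE]]] _] := krK.
have orth' p m : Kp p -> Km m -> form m p = 0.
  by move=> Kpp Kmm; rewrite hermC orth// rmorph0 mulr0.
have [p Kpp [m Kmm ->]] := dec f; have [q Kpq [n Kmn ->]] := dec g.
rewrite !JE// !linearBl !linearDl !linearBr !linearDr /=.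
by rewrite (orth p n)// (orth' q m)// subr0 addr0 sub0r opprK add0r.
Qed.

Lemma J_inner_J (f g : K) : J_inner form J (J f) (J g) = J_inner form J f g.
Proof. exact: form_J. Qed.

Lemma J_norm_J (f : K) : J_norm form J (J f) = J_norm form J f.
Proof. by rewrite /J_norm J_inner_J. Qed.

(** Definiteness is inherited from the norm of [K], which is the J-norm. *)
Lemma J_inner_definite (f : K) : J_inner form J f f = 0 -> f = 0.
Proof.
move=> f0; apply/eqP; rewrite -normr_eq0 (proj2 krK) /J_norm f0 /=.
by rewrite sqrtr0.
Qed.

Lemma J_continuous : continuous J.
Proof.
move=> f; apply/cvgrPdist_lt => e e0; near=> g.
rewrite -J_sub (proj2 krK) J_norm_J -(proj2 krK).
by near: g; apply: cvgr_dist_lt.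
Unshelve. all: by end_near. Qed.

Lemma subspace_J (W : set K) : Defs.subspace W -> Defs.subspace (J @` W).
Proof.
rewrite !subspaceP (image_involutive _ J_involutive) /= J_zero => -[W0 WD].
by split=> // a f g Wf Wg; rewrite J_linear; apply: WD.
Qed.

Lemma closed_J (W : set K) : closed W -> closed (J @` W).
Proof.
rewrite (image_involutive _ J_involutive).
by apply: closed_comp => f _; apply: J_continuous.
Qed.

(** This turns each implication from a set to its image into an equivalence. *)
Lemma image_JK (W : set K) : J @` (J @` W) = W.
Proof.
rewrite !(image_involutive _ J_involutive); apply/seteqP.
by split=> f /=; rewrite J_involutive.
Qed.

Lemma J_nonneg_J (W : set K) : J_nonneg form W -> J_nonneg form (J @` W).
Proof.
move=> [sW Wpos]; split; first exact: subspace_J.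
by move=> _ [f Wf <-]; rewrite form_J Wpos.
Qed.

Lemma J_negative_J (W : set K) : J_negative form W -> J_negative form (J @` W).
Proof.
move=> [sW Wneg]; split; first exact: subspace_J.
move=> _ [f Wf <-] Jf0; rewrite form_J Wneg//.
by apply: contra Jf0 => /eqP ->; rewrite J_zero.
Qed.

Lemma unif_J_positive_J (W : set K) :
  unif_J_positive form J W -> unif_J_positive form J (J @` W).
Proof.
move=> [sW [a a0 Wa]]; split; first exact: subspace_J.
by exists a => // _ [f Wf <-]; rewrite form_J J_norm_J Wa.
Qed.

Lemma unif_J_negative_J (W : set K) :
  unif_J_negative form J W -> unif_J_negative form J (J @` W).
Proof.
move=> [sW [a a0 Wa]]; split; first exact: subspace_J.
by exists a => // _ [f Wf <-]; rewrite form_J J_norm_J Wa.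
Qed.

(** If [N] contains the image of [M], then the image of [N] contains [M] and satisfies [P], so it
    equals [M]. *)
Lemma maximal_J (P : set K -> Prop) (M : set K) :
  (forall N, P N -> P (J @` N)) -> maximal P M -> maximal P (J @` M).
Proof.
move=> PJ [PM Mmax]; split; first exact: PJ.
move=> N PN JMN; rewrite -(Mmax (J @` N)) ?image_JK//; first exact: PJ.
by rewrite -[M]image_JK; apply: image_subset.
Qed.

(** The difference of two candidates lies in [W] and is orthogonal to [W], hence to itself. *)
Lemma J_inner_projection_subset1 (W : set K) (f : K) : Defs.subspace W ->
  is_subset1 [set g | W g /\ forall w, W w -> J_inner form J (f - g) w = 0].
Proof.
move=> /subspaceP[_ WD] g h /= [Wg fg] [Wh fh].
have Wgh : W (g - h) by rewrite addrC -scaleN1r; apply: WD.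
apply/eqP; rewrite -subr_eq0; apply/eqP/J_inner_definite.
have gh : g - h = (f - h) - (f - g) by rewrite opprB [RHS]addrC subrKA.
rewrite [X in J_inner _ _ X _]gh /J_inner J_sub linearBl /=.
have := fg _ Wgh; have := fh _ Wgh; rewrite /J_inner => -> ->.
by rewrite subrr.
Qed.

Lemma J_orth_proj (W : set K) (f : K) : Defs.subspace W ->
  orth_proj (J_inner form J) (J @` W) (J f)
    = J (orth_proj (J_inner form J) W f).
Proof.
move=> sW; apply: orth_proj_involutive.
- exact: J_involutive.
- exact: J_sub.
- exact: J_inner_J.
- exact: J_inner_projection_subset1.
Qed.

(** * Families of subspaces, their l2-sums and synthesis operators *)

Section family.
Variables (I : choiceType) (v : I -> R).
Implicit Types (W : I -> set K) (A : set I) (x : I -> K).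

Lemma I_plus_J W : I_plus form (fun i => J @` W i) = I_plus form W.
Proof.
apply/seteqP; split=> i /J_nonneg_J //; rewrite /I_plus /=.
by rewrite image_JK.
Qed.

Lemma I_minus_J W : I_minus form (fun i => J @` W i) = I_minus form W.
Proof.
have J0 : J @` [set 0] = [set 0] by rewrite image_set1 J_zero.
apply/seteqP; split=> i [Wi0 /J_negative_J Wi]; split => //.
- by move=> Wi0'; apply: Wi0; rewrite Wi0'.
- by rewrite -[W i]image_JK.
- by move=> Wi0'; apply: Wi0; rewrite -[W i]image_JK Wi0'.
Qed.

Lemma l2_sum_J W :
  l2_sum form J (fun i => J @` W i) = (fun x => J \o x) @` l2_sum form J W.
Proof.
rewrite (image_involutive _ (involutive_comp J_involutive)).
have norm_x x : (fun i => (J_norm form J ((J \o x) i) ^+ 2)%:E)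
    = (fun i => (J_norm form J (x i) ^+ 2)%:E).
  by apply/funext => i; rewrite /= J_norm_J.
apply/seteqP; rewrite /l2_sum; split=> x /=; rewrite norm_x => -[Wx x2].
  by split=> // i; have [f Wf <-] := Wx i; rewrite J_involutive.
by split=> // i; exists (J (x i)) => //; rewrite J_involutive.
Qed.

Lemma l2_sum_on_J W A :
  l2_sum_on form J (fun i => J @` W i) A
    = (fun x => J \o x) @` l2_sum_on form J W A.
Proof.
rewrite /l2_sum_on l2_sum_J.
rewrite !(image_involutive _ (involutive_comp J_involutive)).
apply/seteqP; split=> x /= [Wx x0]; split=> // i /x0 /=.
  by move=> ->; rewrite J_zero.
by move=> /(congr1 J); rewrite J_involutive J_zero.
Qed.

Lemma l2_inner_J x y :
  l2_inner form J (J \o x) (J \o y) = l2_inner form J x y.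
Proof.
rewrite /l2_inner; apply: congr1; apply/funext => i; exact: J_inner_J.
Qed.

Lemma l2_sum_single W i (f : K) : (forall j, Defs.subspace (W j)) -> W i f ->
  l2_sum form J W (fun j => if j == i then f else 0).
Proof.
move=> sW Wf; split=> [j|].
  by case: eqP => [->//|_]; have /subspaceP[] := sW j.
rewrite (esumID [set i]); last by move=> j _; rewrite lee_fin sqr_ge0.
rewrite setTI esum_set1 ?lee_fin ?sqr_ge0// esum1 ?adde0 ?ltry//.
move=> j [_ /= /eqP/negPf ->].
by rewrite /J_norm /J_inner linear0r/= sqrtr0 expr0n.
Qed.

(* Testing against families supported at one index pins down the projection
   coordinatewise, so no completeness or convergence in l2 is involved. *)
Lemma l2_projection_subset1 W A x : (forall j, Defs.subspace (W j)) ->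
  l2_sum form J W x ->
  is_subset1 [set g | l2_sum_on form J W A g /\
    forall w, l2_sum_on form J W A w -> l2_inner form J (x - g) w = 0].
Proof.
move=> sW [Wx _].
suff proj_eq g : l2_sum_on form J W A g ->
    (forall w, l2_sum_on form J W A w -> l2_inner form J (x - g) w = 0) ->
    forall i, A i -> g i = x i.
  move=> g h /= [Wg xg] [Wh xh]; apply/funext => i.
  have [Ai|nAi] := pselect (A i); first by rewrite (proj_eq g)// (proj_eq h).
  by rewrite (proj2 Wg)// (proj2 Wh).
move=> [[Wg _] g0] xg i Ai.
have Wxg : W i (x i - g i).
  by have /subspaceP[_ WD] := sW i; rewrite addrC -scaleN1r; apply: WD.
apply/esym/eqP; rewrite -subr_eq0; apply/eqP/J_inner_definite.
(* The test family carries the error [x i - g i] itself, so the sum collapses to its J-inner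
   square. *)
have := xg (fun j => if j == i then x i - g i else 0).
rewrite /l2_inner (@usum_single _ _ _ _ i) ?eqxx; last first.
  by move=> j /negPf ->; rewrite /J_inner linear0r.
apply; split; first exact: l2_sum_single.
by move=> j nAj; case: eqP => // ji; rewrite ji in nAj.
Qed.

Lemma synthesis_J x : synthesis v (J \o x) = J (synthesis v x).
Proof.
rewrite /synthesis -usum_involutive.
- by congr usum; apply/funext => i /=; rewrite J_scale.
- exact: J_involutive.
- exact: J_add.
- exact: J_zero.
- exact: J_continuous.
Qed.

Lemma synthesis_on_J W A x : (forall j, Defs.subspace (W j)) ->
  l2_sum form J W x ->
  synthesis_on form J (fun i => J @` W i) v A (J \o x)
    = J (synthesis_on form J W v A x).
Proof.
move=> sW Wx; rewrite /synthesis_on l2_sum_on_J -synthesis_J; congr synthesis.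
(* The involution is now [J] acting coordinatewise on [I -> K]. *)
apply: (orth_proj_involutive (s := fun x : I -> K => J \o x)).
- exact/involutive_comp/J_involutive.
- by move=> y z; apply/funext => i; exact: J_sub.
- exact: l2_inner_J.
- exact: l2_projection_subset1.
Qed.

Lemma synthesis_range_J W A : (forall j, Defs.subspace (W j)) ->
  synthesis_on form J (fun i => J @` W i) v A
      @` l2_sum form J (fun i => J @` W i)
    = J @` (synthesis_on form J W v A @` l2_sum form J W).
Proof.
move=> sW; rewrite l2_sum_J.
apply/seteqP; split=> [_ [_ [x Wx <-] <-]|_ [_ [x Wx <-] <-]].
  rewrite synthesis_on_J//.
  by exists (synthesis_on form J W v A x) => //; exists x.
by rewrite -synthesis_on_J//; exists (J \o x) => //; exists x.
Qed.

End family.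

End krein.

Theorem lemma2p1 (R : realType) (K : completeNormedModType R[i])
  (form : {hermitian_sym K for Num.conj}) (J : K -> K)
  (I : choiceType) (W : I -> set K) (v : I -> R) :
  krein_space form J ->
  J_fusion_frame form J W v ->
  J_fusion_frame form J (fun i => J @` W i) v.
Proof.
move=> krK [Wfam [B WB] Wpos Wneg].
have sW i : Defs.subspace (W i) by have [] := Wfam i.
split.
- move=> i; have [sWi cWi vi Wi] := Wfam i; split=> //.
  + exact: (subspace_J krK).
  + exact: (closed_J krK).
  + case: Wi => Wi; first by left; exact: (J_nonneg_J krK).
    by right; exact: (J_negative_J krK).
(* Writing [f] as [J (J f)] reduces the claim to the bound for [W] at [J f], with the same [B]. *)
- exists B => f; rewrite -[f](J_involutive krK) (J_norm_J krK).
  under eq_esum do rewrite (J_orth_proj krK) // (J_norm_J krK).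
  exact: WB.
(* The index set is unchanged, so the new range is the image under [J] of the old one. *)
- rewrite (I_plus_J krK) (synthesis_range_J krK)//.
  by apply: (maximal_J krK) => //; exact: (unif_J_positive_J krK).
- rewrite (I_minus_J krK) (synthesis_range_J krK)//.
  by apply: (maximal_J krK) => //; exact: (unif_J_negative_J krK).
Qed.
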